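(* Let $(X,r)$ be a solution. The elements $x^{[d_x]}$, $x \in X$, generate a normal subgroup $Z_{(X,r)}$ of the structure group $G_{(X,r)}$. This subgroup is free abelian of rank $K_r$. The quotient $\overline{G}_{(X,r)} = G_{(X,r)}/Z_{(X,r)}$ is finite. Finally, the natural map $\iota \colon X \to G_{(X,r)}$, $x\mapsto x$, is injective if and only if its composition with the quotient map $G_{(X,r)} \to \overline{G}_{(X,r)}$ is injective.
   Context: A solution $(X,r)$ is a finite set $X$ with a bijection $r\colon X\times X\to X\times X$, $r(x,y)=(\sigma_x(y),\tau_y(x))$, satisfying the Yang--Baxter equation $r_1r_2r_1=r_2r_1r_2$ on $X^3$ ($r_1=r\times \mathrm{Id}_X$, $r_2=\mathrm{Id}_X\times r$), with all maps $\sigma_x,\tau_x\colon X\to X$ bijective. Its structure group is $G_{(X,r)}=\langle X \mid xy=\sigma_x(y)\tau_y(x),\ x,y\in X\rangle$. Its (right) structure rack is $(X,\triangleleft_r)$ with $x\triangleleft_r y=\tau_y\sigma_{\tau_x^{-1}(y)}(x)$; put $\rho_y\colon x\mapsto x\triangleleft_r y$ (a bijection of $X$). $K_r$ is the number of orbits of $X$ under the permutations $\rho_y$, $y\in X$. The group $G_{(X,r)}$ acts on the set $X$ on the right, the generator $y$ acting by $x\mapsto x\leftharpoondown y=\tau_y(x)$, and on the left, the generator $y$ acting by $x\mapsto y\rightharpoondown x=\sigma_y(x)$. Let $G'_{(X,\triangleleft_r)}=\langle X\mid xy=(y\triangleleft_r x)\,x,\ x,y\in X\rangle$, on which $G_{(X,r)}$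 acts on the right by group automorphisms with the generator $y\in X$ sending the generator $x\in X$ to $\tau_y(x)$. There is a unique bijective group $1$-cocycle $J\colon G_{(X,r)}\to G'_{(X,\triangleleft_r)}$ (i.e. $J(gh)=J(g)^{h}J(h)$) with $J(x)=x$ for all $x\in X$. For $y\in X$ and a positive integer $d$, put $y^{[d]}=J^{-1}(y^d)\in G_{(X,r)}$; equivalently, $y^{[d]}=T^{d-1}(y)\cdots T(y)\,y$, where $T\colon X\to X$, $T(x)=\tau_x^{-1}(x)$. The degree $d_y$ of $y\in X$ is the minimal positive integer $d$ (it exists) such that: (1) $d$ is even if $\rho_y=\mathrm{Id}_X$; (2) $\rho_y^d=\mathrm{Id}_X$; (3) $x\leftharpoondown y^{[d]}=y^{[d]}\rightharpoondown x=x$ for all $x\in X$. *)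

(* Defs.v *)
From HB Require Import structures.
From mathcomp Require Import all_boot all_order all_algebra all_fingroup.
From mathcomp Require Import all_classical.

Set Implicit Arguments.
Unset Strict Implicit.
Unset Printing Implicit Defensive.

Local Open Scope classical_set_scope.
Local Open Scope quotient_scope.
Local Open Scope group_scope.

(* The letter (x, true) stands for x, and (x, false) for x^-1. *)
Definition word (X : Type) := seq (X * bool).

HB.instance Definition _ (X : choiceType) := Choice.on (word X).

Section Presentation.
Variables (X : choiceType) (E : word X -> word X -> Prop).

Inductive pres_eq : word X -> word X -> Prop :=
| pres_refl u : pres_eq u u
| pres_sym u v : pres_eq u v -> pres_eq v u
| pres_trans u v w : pres_eq u v -> pres_eq v w -> pres_eq u w
| pres_cat u u' v v' : pres_eq u u' -> pres_eq v v' ->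
    pres_eq (u ++ v) (u' ++ v')
| pres_cancel x b : pres_eq [:: (x, b); (x, ~~ b)] [::]
| pres_rel u v : E u v -> pres_eq u v.

Lemma pres_eqb_equiv : equiv_class_of (fun u v => `[< pres_eq u v >]).
Proof.
split=> [u|u v|v u w /asboolP uv /asboolP vw]; first exact/asboolP/pres_refl.
  by apply/asboolP/asboolP; apply: pres_sym.
exact/asboolP/(pres_trans uv vw).
Qed.

Canonical pres_equiv := EquivRelPack pres_eqb_equiv.

(* The group < X | u = v for E u v >. *)
Definition presented := {eq_quot pres_equiv}.

HB.instance Definition _ := Choice.on presented.
HB.instance Definition _ := EqQuotient.on presented.

Definition word_inv (w : word X) : word X := rev [seq (l.1, ~~ l.2) | l <- w].

Definition pres_one : presented := \pi_presented [::].
Definition pres_mul (g h : presented) : presented :=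
  \pi_presented (generic_quotient.repr g ++ generic_quotient.repr h).
Definition pres_inv (g : presented) : presented :=
  \pi_presented (word_inv (generic_quotient.repr g)).

Lemma eq_pres u v : pres_eq u v <-> \pi_presented u = \pi_presented v.
Proof.
by split=> [/asboolP uv|/eqquotP/asboolP//]; apply/eqquotP.
Qed.

Lemma repr_pres u : pres_eq (generic_quotient.repr (\pi_presented u)) u.
Proof. by apply/eq_pres; rewrite reprK. Qed.

Lemma pres_mulE u v :
  pres_mul (\pi_presented u) (\pi_presented v) = \pi_presented (u ++ v).
Proof. by apply/eq_pres/pres_cat; apply: repr_pres. Qed.

Lemma word_invK : involutive word_inv.
Proof.
move=> w; rewrite /word_inv map_rev revK -map_comp map_id_in // => -[x b] _.
by rewrite /= negbK.
Qed.

Lemma pres_word_inv w : pres_eq (w ++ word_inv w) [::].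
Proof.
elim: w => [|[x b] w IHw]; first exact: pres_refl.
rewrite /word_inv /= rev_cons -cats1 catA -/(word_inv w) -cat1s.
apply: pres_trans (pres_cancel x b).
apply: (pres_cat (pres_refl [:: (x, b)])).
exact: pres_cat IHw (pres_refl _).
Qed.

Lemma pres_mulA : associative pres_mul.
Proof.
move=> g h k; rewrite -(reprK g) -(reprK h) -(reprK k).
move: (generic_quotient.repr _) (generic_quotient.repr _)
  (generic_quotient.repr _) => w v u.
by rewrite (pres_mulE v w) (pres_mulE u v) !pres_mulE catA.
Qed.

Lemma pres_mul1 : left_id pres_one pres_mul.
Proof. by move=> g; rewrite -(reprK g) pres_mulE. Qed.

Lemma pres_1mul : right_id pres_one pres_mul.
Proof. by move=> g; rewrite -(reprK g) pres_mulE cats0. Qed.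

Lemma pres_mulV : right_inverse pres_one pres_inv pres_mul.
Proof.
move=> g; rewrite -{1}(reprK g) pres_mulE.
exact/eq_pres/pres_word_inv.
Qed.

Lemma pres_Vmul : left_inverse pres_one pres_inv pres_mul.
Proof.
move=> g; rewrite -{2}(reprK g) pres_mulE.
rewrite -{2}(word_invK (generic_quotient.repr g)); exact/eq_pres/pres_word_inv.
Qed.

HB.instance Definition _ := isGroup.Build presented
  pres_mulA pres_mul1 pres_1mul pres_Vmul pres_mulV.

Definition pgen (x : X) : presented := \pi_presented [:: (x, true)].

Section Lift.
Variables (H : groupType) (f : X -> H).

Definition word_eval (w : word X) : H :=
  \prod_(l <- w) (if l.2 then f l.1 else (f l.1)^-1).

(* Independent of the representative only when f respects E, in which case it
   is the unique group morphism mapping pgen x to f x. *)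
Definition pres_lift (g : presented) : H := word_eval (generic_quotient.repr g).

Hypothesis fE : forall u v, E u v -> word_eval u = word_eval v.

Lemma word_eval_pres u v : pres_eq u v -> word_eval u = word_eval v.
Proof.
elim=> {u v}// [u v w _ -> _ -> //|u u' v v' _ uE _ vE|x b].
  by rewrite /word_eval !big_cat /= -/(word_eval _) uE -/(word_eval _) vE.
by rewrite /word_eval !big_cons big_nil /=; case: b; rewrite /= mulg1 ?mulgV ?mulVg.
Qed.

Lemma pres_lift_pi w : pres_lift (\pi_presented w) = word_eval w.
Proof. exact/word_eval_pres/repr_pres. Qed.

Lemma pres_lift_gen x : pres_lift (pgen x) = f x.
Proof. by rewrite pres_lift_pi /word_eval big_seq1. Qed.

Lemma pres_liftM : {morph pres_lift : g h / g * h}.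
Proof. by move=> g h; rewrite [LHS]pres_lift_pi /word_eval big_cat. Qed.
End Lift.
End Presentation.

Arguments pgen {X E} x.
Arguments pres_lift {X E H} f g.

Definition r1 (X : Type) (r : X * X -> X * X) (p : X * X * X) : X * X * X :=
  let: (x, y, z) := p in let: (x', y') := r (x, y) in (x', y', z).

Definition r2 (X : Type) (r : X * X -> X * X) (p : X * X * X) : X * X * X :=
  let: (x, y, z) := p in let: (y', z') := r (y, z) in (x, y', z').

Record solution (X : finType) := Solution {
  sol_map :> X * X -> X * X;
  sol_bij : bijective sol_map;
  sol_ybe : forall p : X * X * X,
    r1 sol_map (r2 sol_map (r1 sol_map p))
      = r2 sol_map (r1 sol_map (r2 sol_map p));
  sol_left : forall x, bijective (fun y => (sol_map (x, y)).1);
  sol_right : forall y, bijective (fun x => (sol_map (x, y)).2)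
}.

Section Solution.
Variables (X : finType) (r : solution X).

(* r (x, y) = (sigma x y, tau y x) *)
Definition sigma (x : X) : {perm X} := perm (bij_inj (sol_left r x)).
Definition tau (y : X) : {perm X} := perm (bij_inj (sol_right r y)).

Lemma sol_mapE x y : r (x, y) = (sigma x y, tau y x).
Proof. by rewrite !permE; case: (r _). Qed.

Lemma ybeE x y z :
  [/\ sigma x (sigma y z) = sigma (sigma x y) (sigma (tau y x) z),
      tau (sigma (tau y x) z) (sigma x y) = sigma (tau (sigma y z) x) (tau z y)
    & tau z (tau y x) = tau (tau z y) (tau (sigma y z) x)].
Proof.
have := sol_ybe r (x, y, z).
by rewrite /r1 /r2 /= !sol_mapE /= => -[-> -> ->].
Qed.

(* x <|_r y *)
Definition rack (x y : X) : X := tau y (sigma ((tau x)^-1 y) x).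

Lemma rack_inj y : injective (rack^~ y).
Proof.
move=> x x' /perm_inj sxx'.
set z := (tau x)^-1 y in sxx'; set z' := (tau x')^-1 y in sxx'.
have : r (z, x) = r (z', x') by rewrite !sol_mapE sxx' !permKV.
by move/(bij_inj (sol_bij r)) => [].
Qed.

Definition rho (y : X) : {perm X} := perm (@rack_inj y).

(* K_r *)
Definition rack_orbits : nat :=
  #|orbit 'P <<rho @: [set: X]%SET>> @: [set: X]%SET|.

Definition struct_rel (u v : word X) : Prop := exists x y : X,
  u = [:: (x, true); (y, true)] /\
  v = [:: (sigma x y, true); (tau y x, true)].

Definition struct_group := presented struct_rel.

Definition rack_rel (u v : word X) : Prop := exists x y : X,
  u = [:: (x, true); (y, true)] /\ v = [:: (rack y x, true); (x, true)].

(* G'_(X, <|_r) *)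
Definition rack_group := presented rack_rel.

HB.instance Definition _ := Group.on struct_group.
HB.instance Definition _ := Group.on rack_group.

Definition struct_gen : X -> struct_group := pgen.

(* In {perm X}, (s * t) x = t (s x), so that right actions on X are morphisms
   to {perm X}, and a left action is described by the inverse permutations. *)
Definition ract (x : X) (g : struct_group) : X := pres_lift tau g x.
Definition lact (g : struct_group) (x : X) : X :=
  (pres_lift (fun y => (sigma y)^-1) g)^-1 x.

(* The automorphism by which g acts maps each generator x to ract x g. *)
Definition raut (a : rack_group) (g : struct_group) : rack_group :=
  pres_lift (fun x => pgen (ract x g) : rack_group) a.

Lemma tau_respects u v :
  struct_rel u v -> word_eval tau u = word_eval tau v.
Proof.
move=> [y [z [-> ->]]]; apply/permP => x.
rewrite /word_eval !big_cons !big_nil /= !mulg1 !permM.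
by case: (ybeE x y z).
Qed.

Lemma sigma_respects u v : struct_rel u v ->
  word_eval (fun y => (sigma y)^-1) u = word_eval (fun y => (sigma y)^-1) v.
Proof.
move=> [y [z [-> ->]]].
rewrite /word_eval !big_cons !big_nil /= !mulg1 -!invMg; congr (_^-1).
by apply/permP => x; rewrite !permM; case: (ybeE y z x).
Qed.

Lemma ractM x g h : ract x (g * h) = ract (ract x g) h.
Proof. by rewrite /ract (pres_liftM tau_respects) permM. Qed.

Lemma ract_gen x y : ract x (struct_gen y) = tau y x.
Proof. by rewrite /ract (pres_lift_gen tau_respects). Qed.

Lemma lactM x g h : lact (g * h) x = lact g (lact h x).
Proof. by rewrite /lact (pres_liftM sigma_respects) invMg permM. Qed.

Lemma lact_gen x y : lact (struct_gen y) x = sigma y x.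
Proof. by rewrite /lact (pres_lift_gen sigma_respects) invgK. Qed.

Lemma tau_rack z x y : tau z (rack x y) = rack (tau z x) (tau z y).
Proof.
rewrite /rack -(permKV (tau x) y) permK; move: ((tau x)^-1 y) => w.
case: (ybeE (sigma w x) (tau x w) z) => _ _ ->.
case: (ybeE w x z) => _ -> ->.
by rewrite permK.
Qed.

Lemma ract_rack g x y : ract (rack x y) g = rack (ract x g) (ract y g).
Proof.
rewrite /ract /pres_lift; elim: (generic_quotient.repr g) x y => [|[z b] w IHw] x y.
  by rewrite /word_eval big_nil !perm1.
rewrite /word_eval big_cons -/(word_eval tau w) !permM -IHw; congr (_ _).
case: b => /=; first exact: tau_rack.
by apply: (@perm_inj _ (tau z)); rewrite tau_rack !permKV.
Qed.

Lemma raut_respects g u v :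
  rack_rel u v ->
  word_eval (fun x => pgen (ract x g) : rack_group) u
    = word_eval (fun x => pgen (ract x g) : rack_group) v.
Proof.
move=> [x [y [-> ->]]]; rewrite /word_eval !big_cons !big_nil /= !mulg1.
rewrite ract_rack [LHS]pres_mulE [RHS]pres_mulE; apply/eq_pres/pres_rel.
by exists (ract x g), (ract y g).
Qed.

Lemma rautM g : {morph raut^~ g : a b / a * b}.
Proof. exact: pres_liftM (@raut_respects g). Qed.

Lemma raut_gen x y : raut (pgen x) (struct_gen y) = pgen (tau y x).
Proof. by rewrite /raut (pres_lift_gen (@raut_respects _)) ract_gen. Qed.

Definition is_cocycle (J : struct_group -> rack_group) :=
  forall g h, J (g * h) = raut (J g) h * J h.

(* The cocycle J is determined by its properties, so that xget makes no actual
   choice here; nor does it in bpow, since J is bijective. *)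
Definition structure_cocycle : struct_group -> rack_group :=
  xget (fun=> 1) [set J | [/\ is_cocycle J, bijective J &
    forall x, J (struct_gen x) = pgen x]].

(* y^[d] = J^-1 (y^d) *)
Definition bpow (y : X) (d : nat) : struct_group :=
  xget 1 [set g | structure_cocycle g = pgen y ^+ d].

Definition degree_cond (y : X) (d : nat) : Prop :=
  [/\ (0 < d)%N, rho y = 1 -> ~~ odd d, rho y ^+ d = 1
    & forall x, ract x (bpow y d) = x /\ lact (bpow y d) x = x].

Definition degree (y : X) : nat :=
  xget 0%N [set d | degree_cond y d /\
    forall e, degree_cond y e -> (d <= e)%N].
End Solution.

Section Subgroups.
Variable G : groupType.
Implicit Types (H S : set G) (g : G).

Definition is_subgroup H :=
  [/\ H 1, forall g h, H g -> H h -> H (g * h) & forall g, H g -> H g^-1].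

Definition is_normal_subgroup H :=
  is_subgroup H /\ forall g h, H h -> H (h ^ g).

Definition subgroup_generated S : set G := smallest is_subgroup S.

Definition left_coset H g : set G := [set g * h | h in H].

(* The underlying set of G / H. *)
Definition left_cosets H : set (set G) := range (left_coset H).

Definition free_abelian_of_rank H (n : nat) :=
  exists phi : 'rV[int]_n -> G,
    [/\ forall u v, phi (u + v)%R = phi u * phi v, injective phi
      & range phi = H].
End Subgroups.

(* Z_(X, r) *)
Definition degree_subgroup (X : finType) (r : solution X) :
    set (struct_group r) :=
  subgroup_generated (range (fun x => bpow r x (degree r x))).
Arguments degree_subgroup {X} r _.

(* Main.v *)
Require Import Defs.
From mathcomp Require Import all_boot all_order all_algebra all_fingroup.
From mathcomp Require Import all_classical.
From mathcomp Require Import zify.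
From HB Require Import structures.

(** Write [J] for the cocycle from the structure group [G] to the rack group
[G'], and [N] for the set of elements of [G] that act trivially on the left and
on the right; [N] is normal and of finite index, since [G] acts through finite
groups of permutations.  As [J (g n) = J g * J n] for [n] in [N], questions on
the subgroup [Z] spanned by the [x^[d_x]], which lie in [N], become questions
on the powers [x^d_x] in [G'].

In [G'], conjugation by [x] permutes the generators by [rho_x], so [x^d] is
central as soon as [rho_x^d = 1] ([rgenX_central]), and then depends only on the
rack orbit of [x] ([rgen_rackX]).  The degree [d_x] is also constant on rack
orbits ([degree_rack]) and invariant under the action of [G]
([degree_ract]), and [g^-1 x^[d_x] g = (x.g)^[d_x.g]] ([central_gen_ract]):
hence [Z] is normal, and it is spanned by commuting elements, one for each rack
orbit.

These elements are independent: counting generators by orbits is a morphism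
from [G'] to [Z^K] ([rack_degree]), where it sends them to the multiples
[d_x e_x] of the basis vectors.  This makes [Z] free abelian of rank [K].

For the index, [G'] modulo the image of [Z] is generated by finitely many
elements of finite order, permuted by conjugation.  The argument of Dietzmann's
lemma applies: a word in which [x] occurs [d_x] times can be rewritten with
those occurrences gathered in front ([rack_word_extract]), where they are a
factor in the image of [Z] that can be dropped; so words of bounded length
represent all classes.

Finally, the parity condition forces [d_x >= 2] ([degree_gt1]).  If [x] and [y]
have the same class modulo [Z], the vector [e_y - e_x] has entries among
[-1, 0, 1] and divisible by the degrees, so it vanishes; the element of [Z]
relating [x] to [y] is then trivial.

That [J] exists and is bijective has to be shown first.  It comes from the
affine right action [a |-> a^y * y] of [G] on the set [G'] ([affine_respects]),
and its inverse from an action of [G'] on the set [G] by the maps that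
correspond under [J] to left multiplications ([translation_respects]). *)

Set Implicit Arguments.
Unset Strict Implicit.
Unset Printing Implicit Defensive.

Local Open Scope classical_set_scope.
Local Open Scope quotient_scope.
Local Open Scope group_scope.

(** * The group of bijections of a type *)

(** A presented group acts on an infinite set through a morphism to this group.
The inverse map is part of the data so that inversion needs no choice. *)
Record bijection (T : Type) := Bijection {
  bij_fun :> T -> T;
  bij_inv : T -> T;
  bij_funK : cancel bij_fun bij_inv;
  bij_invK : cancel bij_inv bij_fun
}.

Section BijectionGroup.
Variable T : Type.
Implicit Types f g h : bijection T.

Lemma bijectionP f g : f =1 g -> f = g.
Proof.
case: f g => [f f' fK f'K] [g g' gK g'K] /= /funext fg; subst g.
have {}f'g' : f' = g' by apply/funext => x; rewrite -{1}(g'K x) fK.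
subst g'; congr Bijection; exact: Prop_irrelevance.
Qed.

HB.instance Definition _ := gen_eqMixin (bijection T).
HB.instance Definition _ := gen_choiceMixin (bijection T).

Definition bijection_one := @Bijection T id id (frefl _) (frefl _).
Definition bijection_inverse f := Bijection (bij_invK f) (bij_funK f).
(** The first factor is applied first, as for permutations. *)
Definition bijection_mul f g :=
  Bijection (can_comp (bij_funK g) (bij_funK f))
            (can_comp (bij_invK f) (bij_invK g)).

Fact bijection_mulA : associative bijection_mul.
Proof. by move=> f g h; apply: bijectionP. Qed.
Fact bijection_mul1 : left_id bijection_one bijection_mul.
Proof. by move=> f; apply: bijectionP. Qed.
Fact bijection_1mul : right_id bijection_one bijection_mul.
Proof. by move=> f; apply: bijectionP. Qed.
Fact bijection_mulV :
  left_inverse bijection_one bijection_inverse bijection_mul.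
Proof. by move=> f; apply: bijectionP => x /=; rewrite bij_invK. Qed.
Fact bijection_Vmul :
  right_inverse bijection_one bijection_inverse bijection_mul.
Proof. by move=> f; apply: bijectionP => x /=; rewrite bij_funK. Qed.

HB.instance Definition _ := isGroup.Build (bijection T)
  bijection_mulA bijection_mul1 bijection_1mul bijection_mulV bijection_Vmul.

Lemma bijM f g x : (f * g) x = g (f x). Proof. by []. Qed.
Lemma bij1 x : (1 : bijection T) x = x. Proof. by []. Qed.
Lemma bij_injective f : injective f. Proof. exact: can_inj (bij_funK f). Qed.
End BijectionGroup.

(** * Presented groups *)

Section PresentedGroup.
Variables (X : choiceType) (E : word X -> word X -> Prop).
Implicit Types g h : presented E.

(** The equivalence in the second premise covers left multiplication by both a
generator and its inverse. *)
Lemma presented_ind (P : presented E -> Prop) :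
    P 1 -> (forall x g, P (pgen x * g) <-> P g) ->
  forall g, P g.
Proof.
move=> P1 PM g; rewrite -(reprK g).
elim: (generic_quotient.repr g) => // -[x b] w Pw.
rewrite -cat1s -pres_mulE -/(mul _ _); case: b; first exact/PM.
apply/(PM x); rewrite /mul /= !pres_mulE -(cat1s (x, false)) catA -pres_mulE.
rewrite (_ : \pi_(presented E) ([:: (x, true)] ++ [:: (x, false)])
             = pres_one E).
  by rewrite pres_mul1.
exact/eq_pres/pres_cancel.
Qed.

Lemma presented_morph_eq (H : groupType) (f f' : presented E -> H) :
    {morph f : g h / g * h} -> {morph f' : g h / g * h} ->
  (forall x, f (pgen x) = f' (pgen x)) -> f =1 f'.
Proof.
move=> fM f'M ff'; have morph1 (k : presented E -> H) :
    {morph k : g h / g * h} -> k 1 = 1.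
  by move=> kM; apply: (mulgI (k 1)); rewrite -kM !mulg1.
apply: presented_ind => [|x g]; first by rewrite !morph1.
by rewrite fM f'M ff'; split=> [/mulgI|->].
Qed.

Section Lift.
Variables (H : groupType) (f : X -> H).
Hypothesis fE : forall u v, E u v -> word_eval f u = word_eval f v.

Lemma pres_lift1 : pres_lift f (1 : presented E) = 1.
Proof. by rewrite [LHS](pres_lift_pi fE) /word_eval big_nil. Qed.

Lemma pres_liftV g : pres_lift f g^-1 = (pres_lift f g)^-1.
Proof.
apply: (mulgI (pres_lift f g)).
by rewrite -pres_liftM // !mulgV pres_lift1.
Qed.
End Lift.

Section Degree.
Variables (A : zmodType) (f : X -> A).

(** The image of a word under a morphism to the additive group [A]; additive
groups are not instances of the multiplicative structure that [word_eval]
takes values in. *)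
Definition word_degree (w : word X) : A :=
  (\sum_(l <- w) (if l.2 then f l.1 else - f l.1))%R.

Definition pres_degree g : A := word_degree (generic_quotient.repr g).

Hypothesis fE : forall u v, E u v -> word_degree u = word_degree v.

Lemma pres_degree_pi w : pres_degree (\pi_(presented E) w) = word_degree w.
Proof.
have E_deg u v : pres_eq E u v -> word_degree u = word_degree v.
  elim=> {u v}// [u v w' _ -> _ -> //|u u' v v' _ uE _ vE|x b].
    rewrite /word_degree !big_cat /=.
    by rewrite -/(word_degree _) uE -/(word_degree _) vE.
  rewrite /word_degree !big_cons big_nil /=.
  by case: b; rewrite /= GRing.addr0 ?GRing.subrr ?GRing.addNr.
exact/E_deg/repr_pres.
Qed.

Lemma pres_degree_gen x : pres_degree (pgen x) = f x.
Proof. by rewrite pres_degree_pi /word_degree big_seq1. Qed.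

Lemma pres_degreeM g h :
  pres_degree (g * h) = (pres_degree g + pres_degree h)%R.
Proof. by rewrite [LHS]pres_degree_pi /word_degree big_cat. Qed.

Lemma pres_degree1 : pres_degree 1 = 0%R.
Proof. by rewrite [LHS]pres_degree_pi /word_degree big_nil. Qed.
End Degree.
End PresentedGroup.

(** * Subgroups generated by commuting elements *)

Section SubgroupGenerated.
Variable G : groupType.
Implicit Types (S H : set G).

Lemma subgroup_generated_subgroup S : is_subgroup (subgroup_generated S).
Proof.
split=> [H [[]//]|g h gS hS H HS|g gS H HS]; case: (HS) => -[_ HM HV] _.
  by apply: HM; [exact: gS|exact: hS].
by apply: HV; exact: gS.
Qed.

Lemma sub_subgroup_generated S : S `<=` subgroup_generated S.
Proof. exact: sub_smallest. Qed.

Lemma subgroup_generated_sub S H :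
  is_subgroup H -> S `<=` H -> subgroup_generated S `<=` H.
Proof. exact: smallest_sub. Qed.
End SubgroupGenerated.

Section IntegerPower.
Variable G : groupType.
Implicit Types g h : G.

Definition expgz g (k : int) : G :=
  match k with Posz n => g ^+ n | Negz n => g ^- n.+1 end.

(** Writing integers as differences of naturals spares the proof of [expgzD] a
case analysis on signs. *)
Lemma expgz_subn g m n : expgz g (m%:Z - n%:Z)%R = g ^+ m * g ^- n.
Proof.
case: (leqP n m) => [nm|/ltnW mn].
  by rewrite subzn //= expgnFr.
rewrite -GRing.opprB subzn //.
have: g ^+ (n - m) = g ^+ n * g ^- m by rewrite expgnFr.
case: (n - m)%N => [|k] e /=.
  by rewrite -invgF -e expg0 invg1.
by rewrite e invgF.
Qed.

Lemma intSubn (k : int) : exists m n : nat, k = (m%:Z - n%:Z)%R.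
Proof.
case: k => n; first by exists n, 0; rewrite GRing.subr0.
by exists 0, n.+1; rewrite GRing.sub0r NegzE.
Qed.

Lemma expgzD g k l : expgz g (k + l)%R = expgz g k * expgz g l.
Proof.
have [m [n ->]] := intSubn k; have [p [q ->]] := intSubn l.
rewrite GRing.addrACA -GRing.opprD -!PoszD !expgz_subn.
rewrite (addnC n) !expgnDr invgM !mulgA; congr (_ * _).
rewrite -!mulgA; congr (_ * _).
exact/commuteV/commuteX2/commute_refl.
Qed.

Lemma expgzV g k : expgz g (- k)%R = (expgz g k)^-1.
Proof. by apply: (mulgI (expgz g k)); rewrite -expgzD GRing.subrr mulgV. Qed.

Lemma commute_expgz g h k l : commute g h -> commute (expgz g k) (expgz h l).
Proof.
have comm1 x y i : commute x y -> commute x (expgz y i).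
  by case: i => n xy; [|apply: commuteV]; apply: commuteX.
by move=> gh; apply/comm1/commute_sym/comm1/commute_sym.
Qed.

Lemma generated_expgz (S : set G) g k : S g -> subgroup_generated S (expgz g k).
Proof.
move=> Sg; have [H1 HM HV] := subgroup_generated_subgroup S.
have HX m : subgroup_generated S (g ^+ m).
  elim: m => // m IHm; rewrite expgS; apply: HM IHm.
  exact: sub_subgroup_generated.
by case: k => m; [|apply: HV]; apply: HX.
Qed.
End IntegerPower.

Section FreeAbelianBasis.
Variables (G : groupType) (n : nat) (z : 'I_n -> G).
Implicit Types u v : 'rV[int]_n.

Definition int_combination u : G := \prod_(i < n) expgz (z i) (u 0%R i).

Hypothesis zC : forall i j, commute (z i) (z j).

Lemma int_combinationD u v :
  int_combination (u + v)%R = int_combination u * int_combination v.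
Proof.
rewrite -prodgM_commute => [|i j _ _]; last exact: commute_expgz.
by apply: eq_bigr => i _; rewrite mxE expgzD.
Qed.

Lemma int_combination0 : int_combination 0%R = 1.
Proof. by rewrite /int_combination big1 // => i _; rewrite mxE. Qed.

Lemma int_combination_delta i : int_combination (delta_mx 0%R i) = z i.
Proof.
transitivity (\prod_(j | j == i) z j); last exact: big_pred1_eq.
rewrite [RHS]big_mkcond.
by apply: eq_bigr => j _; rewrite mxE eqxx /=; case: (j == i).
Qed.

(** Commutation makes the set of all integer combinations a subgroup. *)
Lemma int_combination_range :
  range int_combination = subgroup_generated (range z).
Proof.
apply/seteqP; split=> [_ [u _ <-]|].
  have [H1 HM HV] := subgroup_generated_subgroup (range z).
  by apply: big_ind => // i _; apply: generated_expgz; exists i.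
apply: subgroup_generated_sub => [|_ [i _ <-]].
  split=> [|_ _ [u _ <-] [v _ <-]|_ [u _ <-]].
  - by exists 0%R => //; exact: int_combination0.
  - by exists (u + v)%R => //; exact: int_combinationD.
  exists (- u)%R => //; apply: (mulgI (int_combination u)).
  by rewrite -int_combinationD GRing.subrr mulgV int_combination0.
by exists (delta_mx 0%R i) => //; exact: int_combination_delta.
Qed.

Variables (deg : G -> 'rV[int]_n) (d : 'I_n -> nat).
Hypothesis degM : forall g h,
  subgroup_generated (range z) h -> deg (g * h) = (deg g + deg h)%R.
Hypothesis deg_z : forall i, deg (z i) = ((d i)%:Z *: delta_mx 0 i)%R.

(** A map that is additive when the right factor lies in the subgroup, and takes
the [z i] to multiples of the basis vectors, reads off the exponents. *)
Lemma deg_int_combination u i :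
  deg (int_combination u) 0%R i = (u 0 i * (d i)%:Z)%R.
Proof.
have [H1 HM HV] := subgroup_generated_subgroup (range z).
have deg1 : deg 1 = 0%R.
  by apply: (GRing.addrI (deg 1)); rewrite -degM // mulg1 GRing.addr0.
have Hexp j k : subgroup_generated (range z) (expgz (z j) k).
  by apply: generated_expgz; exists j.
have degX j (k : nat) : deg (z j ^+ k) = (k%:Z *: deg (z j))%R.
  elim: k => [|k IHk]; first by rewrite GRing.scale0r.
  rewrite expgSr degM ?IHk; last exact: (Hexp j 1%R).
  by rewrite -(addn1 k) PoszD GRing.scalerDl GRing.scale1r.
have deg_expgz j (k : int) : deg (expgz (z j) k) = (k *: deg (z j))%R.
  case: k => k; first exact: degX.
  rewrite NegzE GRing.scaleNr -degX; apply: (GRing.addrI (deg (z j ^+ k.+1))).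
  rewrite GRing.subrr expgzV -degM ?mulgV //.
  by apply: HV; apply: (Hexp j k.+1).
suff -> : deg (int_combination u) = (\sum_j u 0 j *: deg (z j))%R.
  rewrite summxE (bigD1 i) //= big1 => [|j ji].
    by rewrite deg_z !mxE !eqxx GRing.mulr1 GRing.addr0.
  by rewrite deg_z !mxE eq_sym (negPf ji) andbF !GRing.mulr0.
suff [] : deg (int_combination u) = (\sum_j u 0 j *: deg (z j))%R /\
          subgroup_generated (range z) (int_combination u) by [].
rewrite /int_combination; elim/big_rec2: _ => [|j x g _ [degx Hx]] //.
by rewrite degM // degx deg_expgz; split=> //; apply: HM.
Qed.
End FreeAbelianBasis.

(** * Self-distributivity of the structure rack *)

Section StructureGroup.
Variables (X : finType) (r : solution X).
Local Notation sigma := (sigma r).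
Local Notation tau := (tau r).
Local Notation rack := (rack r).
Local Notation rho := (rho r).

Lemma rack_tau x y : rack y (tau y x) = tau (tau y x) (sigma x y).
Proof. by rewrite /rack permK. Qed.

(** The point of this map is that it conjugates the solution to the braiding of
its rack, which is how the Yang-Baxter equation turns into
self-distributivity. *)
Definition guitar (p : X * X * X) : X * X * X :=
  (tau p.2 (tau p.1.2 p.1.1), tau p.2 p.1.2, p.2).

Definition rack_braiding (p : X * X) : X * X := (rack p.2 p.1, p.1).

Lemma guitar_r1 p : guitar (r1 r p) = r1 rack_braiding (guitar p).
Proof.
case: p => [[x y] z]; rewrite /guitar /r1 /= sol_mapE /=.
by rewrite -tau_rack rack_tau.
Qed.

Lemma guitar_r2 p : guitar (r2 r p) = r2 rack_braiding (guitar p).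
Proof.
case: p => [[x y] z]; rewrite /guitar /r2 /= sol_mapE /=.
by case: (ybeE r x y z) => _ _ <-; rewrite rack_tau.
Qed.

Lemma guitar_surj q : exists p, guitar p = q.
Proof.
case: q => [[a b] c]; set y := (tau c)^-1 b.
by exists ((tau y)^-1 ((tau c)^-1 a), y, c); rewrite /guitar /= !permKV.
Qed.

Lemma rackD x y z : rack (rack x y) z = rack (rack x z) (rack y z).
Proof.
have [p Ep] := guitar_surj (z, y, x).
have := congr1 guitar (sol_ybe r p).
rewrite !(guitar_r1, guitar_r2) Ep /r1 /r2 /rack_braiding /=.
by case.
Qed.

Lemma rhoE y x : rho y x = rack x y. Proof. by rewrite permE. Qed.

Lemma rho_rack x y : rho (rack x y) = rho x ^ rho y.
Proof.
apply: (mulgI (rho y)); rewrite mulVKg.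
by apply/permP => z; rewrite !permM !rhoE -rackD.
Qed.

(** * The actions on the structure group and the rack group *)

Local Notation ract := Defs.ract.
Local Notation G := (struct_group r).
Local Notation G' := (rack_group r).
Local Notation gen := (struct_gen r).
Local Notation rgen := (@pgen X (@rack_rel X r) : X -> G').

Lemma struct_genC x y : gen x * gen y = gen (sigma x y) * gen (tau y x).
Proof.
by rewrite [LHS]pres_mulE [RHS]pres_mulE; apply/eq_pres/pres_rel; exists x, y.
Qed.

Lemma rack_genC x y : rgen x * rgen y = rgen (rho x y) * rgen x.
Proof.
rewrite rhoE [LHS]pres_mulE [RHS]pres_mulE; apply/eq_pres/pres_rel.
by exists x, y.
Qed.

Lemma ract1 x : ract x (1 : G) = x.
Proof. by rewrite /ract (pres_lift1 (@tau_respects X r)) perm1. Qed.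

Lemma ractK (g : G) : cancel (fun x => ract x g) (fun x => ract x g^-1).
Proof. by move=> x; rewrite -ractM mulgV ract1. Qed.

Lemma ractKV (g : G) : cancel (fun x => ract x g^-1) (fun x => ract x g).
Proof. by move=> x; rewrite -ractM mulVg ract1. Qed.

Lemma raut_rgen x (g : G) : raut (rgen x) g = rgen (ract x g).
Proof. by rewrite /raut (pres_lift_gen (@raut_respects _ _ g)). Qed.

Lemma raut1g (g : G) : raut (1 : G') g = 1.
Proof. by rewrite /raut (pres_lift1 (@raut_respects _ _ g)). Qed.

Lemma raut_id (g : G) (a : G') : (forall x, ract x g = x) -> raut a g = a.
Proof.
move=> gX; apply: (presented_morph_eq (f' := id) (@rautM X r g)) a => // x.
by rewrite [LHS]raut_rgen gX.
Qed.

Lemma rautgM (g h : G) (a : G') : raut a (g * h) = raut (raut a g) h.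
Proof.
have M (k : G) := @rautM X r k.
apply: (presented_morph_eq (M (g * h)) (f' := fun b => raut (raut b g) h)) a.
  by move=> a b /=; rewrite !rautM.
by move=> x; rewrite !raut_rgen ractM.
Qed.

Lemma rautK (g : G) : cancel (fun a : G' => raut a g) (fun a => raut a g^-1).
Proof. by move=> a; rewrite -rautgM mulgV raut_id // => x; exact: ract1. Qed.

Lemma rautKV (g : G) : cancel (fun a : G' => raut a g^-1) (fun a => raut a g).
Proof. by move=> a; rewrite -rautgM mulVg raut_id // => x; exact: ract1. Qed.

(** * The cocycle as the orbit map of an affine action *)

Section AffineAction.
Variable y : X.

Definition affine (a : G') : G' := raut a (gen y) * rgen y.
Definition affine_inv (a : G') : G' := raut (a * (rgen y)^-1) (gen y)^-1.

Fact affineK : cancel affine affine_inv.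
Proof. by move=> a; rewrite /affine_inv /affine mulgK rautK. Qed.

Fact affine_invK : cancel affine_inv affine.
Proof. by move=> a; rewrite /affine_inv /affine rautKV mulgVK. Qed.

Definition affine_bij := Bijection affineK affine_invK.
End AffineAction.

Lemma affine_respects u v :
  struct_rel r u v -> word_eval affine_bij u = word_eval affine_bij v.
Proof.
move=> [x [y [-> ->]]]; apply: bijectionP => a.
rewrite /word_eval !big_cons !big_nil /= .
rewrite /affine !rautM -!rautgM struct_genC -!mulgA; congr (_ * _).
by rewrite !raut_rgen !ract_gen rack_genC rhoE rack_tau.
Qed.

Definition cocycle (g : G) : G' := pres_lift affine_bij g 1.

(** An affine map is determined by its linear part, here [raut^~ g], and its
value at the origin; composing affine maps then gives the cocycle law. *)
Lemma cocycle_affine (g : G) (a : G') :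
  pres_lift affine_bij g a = raut a g * cocycle g.
Proof.
rewrite /cocycle; move: a; move: g.
apply: presented_ind => [a|y g].
  rewrite (pres_lift1 affine_respects) !bij1 mulg1 raut_id // => x.
  exact: ract1.
suff E a : pres_lift affine_bij (pgen y * g) a
           = pres_lift affine_bij g (affine y a).
  split=> Hg a.
    rewrite -(affine_invK y a). rewrite -!E Hg.
    rewrite -[in RHS](affine_invK y 1) -!E. rewrite (Hg (affine_inv y 1)).
    (* [affine y c = 1], so the two factors contributed by [y] cancel *)
    set c := affine_inv y 1; set b := affine_inv y a.
    have cy : rgen y * raut c (gen y) = 1.
      apply: (mulgI (raut c (gen y))).
      by rewrite mulgA -/(affine y c) affine_invK mul1g mulg1.
    rewrite [X in _ = X * _]rautM !mulgA; congr (_ * _).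
    rewrite (rautgM _ _ c) -mulgA -(rautM g) cy raut1g mulg1.
    by rewrite -rautgM.
  by rewrite !E !(Hg (affine _ _)) /affine rautgM raut1g mul1g rautM mulgA.
by rewrite (pres_liftM affine_respects) (pres_lift_gen affine_respects).
Qed.

Lemma cocycleM : is_cocycle cocycle.
Proof.
move=> g h; rewrite -cocycle_affine /cocycle.
by rewrite (pres_liftM affine_respects) bijM.
Qed.

Lemma cocycle_gen x : cocycle (gen x) = rgen x.
Proof.
rewrite /cocycle (pres_lift_gen affine_respects) /= /affine.
by rewrite raut1g mul1g.
Qed.

(** * The inverse of the cocycle *)

(** The map [T], whose bijectivity is what makes the translations below
invertible. *)
Definition twist_fun y : X := (tau y)^-1 y.

Lemma sigma_twist y : sigma (twist_fun y) y = rack (twist_fun y) (twist_fun y).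
Proof.
apply: (@perm_inj _ (tau y)); rewrite tau_rack /twist_fun permKV.
by rewrite /rack.
Qed.

(** By [sigma_twist], [T y] determines [y] as [sigma (T y)^-1] of its rack
square. *)
Lemma twist_inj : injective twist_fun.
Proof.
move=> y y' e; apply: (@perm_inj _ (sigma (twist_fun y))).
by rewrite sigma_twist e sigma_twist.
Qed.

Definition twist : {perm X} := perm twist_inj.

Lemma ract_genV x y : ract x (gen y)^-1 = (tau y)^-1 x.
Proof. by apply: (@perm_inj _ (tau y)); rewrite permKV -ract_gen ractKV. Qed.

Section TwistedTranslation.
Variable x : X.

(** As [J (gen z * g) = rgen (ract z g) * J g], this is left multiplication by
[rgen x], transported through the cocycle. *)
Definition translation (g : G) : G := gen (ract x g^-1) * g.
Definition translation_inv (g : G) : G :=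
  (gen (twist^-1 (ract x g^-1)))^-1 * g.

Fact translationK : cancel translation translation_inv.
Proof.
move=> g; rewrite /translation_inv /translation invgM ractM ract_genV.
by rewrite -/(twist_fun _) -(permE twist_inj) permK mulKg.
Qed.

Fact translation_invK : cancel translation_inv translation.
Proof.
move=> g; rewrite /translation_inv /translation invgM invgK ractM ract_gen.
set y := twist^-1 _; suff -> : tau y (ract x g^-1) = y by rewrite mulVKg.
by rewrite -(permKV twist (ract x g^-1)) -/y [twist y]permE permKV.
Qed.

Definition translation_bij := Bijection translationK translation_invK.
End TwistedTranslation.

Lemma translation_rack x y g :
  translation x (translation y g) = translation (rack y x) (translation x g).
Proof.
rewrite /translation !invgM !ractM !ract_genV !mulgA; congr (_ * _).
rewrite ract_rack; move: (ract x g^-1) (ract y g^-1) => {}x {}y.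
rewrite struct_genC permKV; congr (gen _ * _).
by apply: (@perm_inj _ (tau x)); rewrite permKV.
Qed.

(** Inverses appear because the action is on the left, while products of
bijections compose from left to right. *)
Lemma translation_respects u v :
  rack_rel r u v -> word_eval (fun x => (translation_bij x)^-1) u
                    = word_eval (fun x => (translation_bij x)^-1) v.
Proof.
move=> [x [y [-> ->]]].
rewrite /word_eval !big_cons !big_nil /= !mulg1 -!invgM; congr (_^-1).
by apply: bijectionP => g; rewrite !bijM; exact: translation_rack.
Qed.

Definition cocycle_inv (a : G') : G :=
  (pres_lift (fun x => (translation_bij x)^-1) a)^-1 1.

Lemma cocycle_inv1 : cocycle_inv 1 = 1.
Proof. by rewrite /cocycle_inv (pres_lift1 translation_respects) invg1. Qed.

Lemma cocycle_inv_gen x a :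
  cocycle_inv (rgen x * a) = translation x (cocycle_inv a).
Proof.
rewrite /cocycle_inv (pres_liftM translation_respects).
by rewrite (pres_lift_gen translation_respects) invgM invgK bijM.
Qed.

Lemma cocycle1 : cocycle 1 = 1.
Proof. by rewrite /cocycle (pres_lift1 affine_respects). Qed.

Lemma cocycle_invK : cancel cocycle_inv cocycle.
Proof.
apply: presented_ind => [|x a]; first by rewrite cocycle_inv1 cocycle1.
rewrite cocycle_inv_gen /translation cocycleM cocycle_gen raut_rgen ractKV.
by split=> [/mulgI|->].
Qed.

Lemma cocycleK : cancel cocycle cocycle_inv.
Proof.
apply: presented_ind => [|x g]; first by rewrite cocycle1 cocycle_inv1.
rewrite cocycleM cocycle_gen raut_rgen cocycle_inv_gen.
have E : translation (ract x g) g = pgen x * g by rewrite /translation ractK.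
split=> [|->]; last exact: E.
rewrite -E; exact: (bij_injective (f := translation_bij _)).
Qed.

Local Notation J := (@structure_cocycle X r).

(** * Powers with respect to the cocycle, and degrees *)

Lemma structure_cocycleP :
  [/\ is_cocycle J, bijective J & forall x, J (gen x) = rgen x].
Proof.
rewrite /structure_cocycle; apply: (@xgetPex _ _
  [set J | [/\ is_cocycle J, bijective J & forall x, J (gen x) = rgen x]]).
exists cocycle; split; [exact: cocycleM| |exact: cocycle_gen].
exact: Bijective cocycleK cocycle_invK.
Qed.

Lemma structure_cocycleM : is_cocycle J.
Proof. by case: structure_cocycleP. Qed.

Lemma structure_cocycle_gen x : J (gen x) = rgen x.
Proof. by case: structure_cocycleP. Qed.

Lemma structure_cocycle_inj : injective J.
Proof. by case: structure_cocycleP => _ /bij_inj. Qed.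

Lemma structure_cocycle_surj (a : G') : exists g, J g = a.
Proof. by case: structure_cocycleP => _ [K _ JK] _; exists (K a). Qed.

Lemma structure_cocycle1 : J 1 = 1.
Proof.
apply: (mulgI (J 1)).
by rewrite -{1}(raut_id (J 1) ract1) -structure_cocycleM !mulg1.
Qed.

Lemma bpowE y d : J (bpow r y d) = rgen y ^+ d.
Proof.
have [g Jg] := structure_cocycle_surj (rgen y ^+ d).
exact: (@xgetPex _ _ [set g | J g = rgen y ^+ d] (ex_intro _ g Jg)).
Qed.

Lemma bpow_eq y d g : J g = rgen y ^+ d -> bpow r y d = g.
Proof. by rewrite -bpowE => /structure_cocycle_inj. Qed.

Definition acts_trivially (g : G) := forall x, ract x g = x /\ lact g x = x.

Lemma lact1 x : lact (1 : G) x = x.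
Proof. by rewrite /lact (pres_lift1 (@sigma_respects _ _)) invg1 perm1. Qed.

Lemma acts_triviallyM g h :
  acts_trivially g -> acts_trivially h -> acts_trivially (g * h).
Proof.
move=> gX hX x; have [gr gl] := gX x; have [hr hl] := hX x.
by rewrite ractM lactM gr hr hl gl.
Qed.

Lemma acts_triviallyV g : acts_trivially g -> acts_trivially g^-1.
Proof.
move=> gX x; have [gr gl] := gX x.
by split; [rewrite -{1}gr -ractM mulgV ract1|rewrite -{1}gl -lactM mulVg lact1].
Qed.

Lemma acts_trivially1 : acts_trivially 1.
Proof. by move=> x; rewrite ract1 lact1. Qed.

Lemma acts_triviallyX g k : acts_trivially g -> acts_trivially (g ^+ k).
Proof.
move=> gX; elim: k => [|k IHk]; first exact: acts_trivially1.
by rewrite expgS; apply: acts_triviallyM.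
Qed.

Lemma acts_triviallyJ g h : acts_trivially g -> acts_trivially (g ^ h).
Proof.
move=> gX x; rewrite conjgE !ractM !lactM.
rewrite (gX _).1 (gX _).2 -ractM -lactM mulVg ract1.
by rewrite lact1.
Qed.

Lemma structure_cocycle_trivial g h :
  acts_trivially h -> J (g * h) = J g * J h.
Proof.
by move=> hX; rewrite structure_cocycleM raut_id // => x; case: (hX x).
Qed.

(** On elements acting trivially the cocycle is multiplicative, so there the two
notions of power agree. *)
Lemma bpow_mul y d k :
  acts_trivially (bpow r y d) -> bpow r y (d * k) = bpow r y d ^+ k.
Proof.
move=> tr; apply: bpow_eq; elim: k => [|k IHk].
  by rewrite muln0 structure_cocycle1.
by rewrite expgSr structure_cocycle_trivial // IHk bpowE mulnS addnC expgnDr.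
Qed.

(** Two of the powers [y^[i]], [y^[j]] with [i < j] act in the same way, since
there are finitely many actions; their quotient is [y^[j - i]]. *)
Lemma acts_trivially_bpow y :
  exists d, (0 < d)%N /\ acts_trivially (bpow r y d).
Proof.
pose act (g : G) : {perm X} * {perm X} :=
  (pres_lift tau g, pres_lift (fun y => (sigma y)^-1) g).
pose f (i : 'I_#|{: {perm X} * {perm X}}|.+1) := act (bpow r y i).
have /injectivePn : ~~ injectiveb f.
  by apply/injectiveP => /leq_card; rewrite card_ord ltnn.
case=> i [j neq_ij fij].
wlog ij : i j neq_ij fij / (i < j)%N => [W|].
  case: (ltngtP i j) => [|ji|/val_inj/eqP]; first exact: W.
    by apply: (W j i); rewrite // eq_sym.
  by rewrite (negPf neq_ij).
pose g := (bpow r y i)^-1 * bpow r y j.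
have gX : acts_trivially g.
  move=> x; rewrite /ract /lact.
  rewrite (pres_liftM (@tau_respects _ _)) (pres_liftM (@sigma_respects _ _)).
  rewrite (pres_liftV (@tau_respects _ _)) (pres_liftV (@sigma_respects _ _)).
  by case: fij => -> ->; rewrite !mulVg invg1 !perm1.
exists (j - i)%N; rewrite subn_gt0 ij; split=> //.
suff -> : bpow r y (j - i) = g by [].
apply: bpow_eq; apply: (mulgI (J (bpow r y i))).
rewrite -structure_cocycle_trivial // mulVKg !bpowE -expgnDr subnKC //.
exact: ltnW.
Qed.

Lemma degreeP y : degree_cond r y (degree r y).
Proof.
have [d [d_gt0 dX]] := acts_trivially_bpow y.
have ex : exists e, `[< degree_cond r y e >].
  (* the order gives the second condition, the factor 2 the parity *)
  exists (d * (#[rho y] * 2))%N; apply/asboolP; split.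
  - by rewrite !muln_gt0 d_gt0 order_gt0.
  - by rewrite !oddM !andbF.
  - by rewrite mulnCA expgnA expg_order expg1n.
  - by rewrite bpow_mul //; apply: acts_triviallyX.
suff [] : degree_cond r y (degree r y) /\
  forall e, degree_cond r y e -> (degree r y <= e)%N by [].
apply: (@xgetPex _ _ [set d | degree_cond r y d /\
  forall e, degree_cond r y e -> (d <= e)%N]).
case: (ex_minnP ex) => m /asboolP my m_min; exists m; split=> // e /asboolP.
exact: m_min.
Qed.

Lemma degree_eq y y' :
    (forall d, degree_cond r y d <-> degree_cond r y' d) ->
  degree r y = degree r y'.
Proof.
move=> yy'; rewrite /degree; congr (xget _ _); apply/seteqP.
by split=> d /= [yd min_d]; split=> [|e /yy' /min_d//]; apply/yy'.
Qed.

(** [d = 1] would make [rho y] trivial, and then [d] should be even. *)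
Lemma degree_gt1 y : (1 < degree r y)%N.
Proof.
have [] := degreeP y; case: (degree r y) => [|[|d]] // _.
by rewrite expg1 => odd1 /odd1.
Qed.

Lemma rgenX_rgen x y d :
  rgen x ^+ d * rgen y = rgen ((rho x ^+ d) y) * rgen x ^+ d.
Proof.
elim: d y => [|d IHd] y; first by rewrite perm1 mul1g mulg1.
rewrite (expgSr (rgen x)) (expgS (rho x)) permM.
by rewrite -mulgA rack_genC mulgA IHd -mulgA.
Qed.

Lemma rgenX_central x d (a : G') :
  rho x ^+ d = 1 -> commute (rgen x ^+ d) a.
Proof.
move=> xd; move: a; apply: presented_ind => [|y a]; first exact: commute1.
have xyC : commute (rgen x ^+ d) (rgen y).
  by rewrite /commute rgenX_rgen xd perm1.
split=> xa; last exact: commuteM.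
by rewrite -(mulKg (rgen y) a); apply: commuteM => //; apply: commuteV.
Qed.

(** [rgen (rack y x)] is a conjugate of [rgen y], and the power is central. *)
Lemma rgen_rackX x y d :
  rho y ^+ d = 1 -> rgen (rack y x) ^+ d = rgen y ^+ d.
Proof.
move=> yd; have -> : rgen (rack y x) = rgen y ^ (rgen x)^-1.
  by rewrite -rhoE conjgE invgK mulgA rack_genC mulgK.
by rewrite -conjXg; apply/conjg_fixP/commgP; exact: rgenX_central.
Qed.

Lemma bpow_rack x y d : rho y ^+ d = 1 -> bpow r (rack y x) d = bpow r y d.
Proof. by move=> yd; apply: bpow_eq; rewrite bpowE rgen_rackX. Qed.

Lemma degree_rack x y : degree r (rack y x) = degree r y.
Proof.
apply: degree_eq => d; rewrite /degree_cond rho_rack.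
have rhoX : (rho y ^ rho x) ^+ d = 1 <-> rho y ^+ d = 1.
  by rewrite -conjXg; split=> [/eqP|->]; rewrite ?conj1g // conjg_eq1 => /eqP.
have rho1 : rho y ^ rho x = 1 <-> rho y = 1.
  by split=> [/eqP|->]; rewrite ?conj1g // conjg_eq1 => /eqP.
split=> -[d_gt0 even_d yd tr]; split=> //.
- by move/rho1.
- exact/rhoX.
- by rewrite -(bpow_rack x) //; apply/rhoX.
- by move/rho1.
- exact/rhoX.
- by rewrite bpow_rack.
Qed.

Lemma rho_ract y (g : G) : rho (ract y g) = rho y ^ pres_lift tau g.
Proof.
apply: (mulgI (pres_lift tau g)); rewrite mulVKg.
apply/permP => x; rewrite !permM !rhoE -/(ract x g).
by rewrite -ract_rack.
Qed.

(** Compare [J (y^[d] g)], computed by the cocycle law, with the value of [J] at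
[g (y^[d])^g], where it is multiplicative. *)
Lemma bpow_ract y (g : G) d :
    rho y ^+ d = 1 -> acts_trivially (bpow r y d) ->
  bpow r (ract y g) d = bpow r y d ^ g.
Proof.
move=> yd tr; apply: bpow_eq.
have ygd : rho (ract y g) ^+ d = 1 by rewrite rho_ract -conjXg yd conj1g.
apply: (mulgI (J g)); rewrite -structure_cocycle_trivial;
  last exact: acts_triviallyJ.
rewrite -conjgC structure_cocycleM bpowE -(rgenX_central _ ygd); congr (_ * _).
elim: d {yd tr ygd} => [|d IHd]; first by rewrite raut1g.
by rewrite !expgS rautM raut_rgen IHd.
Qed.

Lemma degree_ract y (g : G) : degree r (ract y g) = degree r y.
Proof.
have imp z (h : G) d : degree_cond r z d -> degree_cond r (ract z h) d.
  case=> d_gt0 even_d zd tr; split=> //.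
  - rewrite rho_ract => /eqP; rewrite conjg_eq1 => /eqP; exact: even_d.
  - by rewrite rho_ract -conjXg zd conj1g.
  - by rewrite bpow_ract //; apply: acts_triviallyJ.
apply: degree_eq => d; split=> [/(imp _ g^-1)|/imp//].
by rewrite ractK.
Qed.

(** * The subgroup spanned by the powers of the generators *)

Local Notation Z := (@degree_subgroup X r).

Definition central_gen x : G := bpow r x (degree r x).

Lemma central_gen_mem x : Z (central_gen x).
Proof. by apply: sub_subgroup_generated; exists x. Qed.

Lemma degree_subgroupP : is_subgroup Z.
Proof. exact: subgroup_generated_subgroup. Qed.

Lemma J_central_gen x : J (central_gen x) = rgen x ^+ degree r x.
Proof. exact: bpowE. Qed.

Lemma degree_subgroup_central h :
  Z h -> acts_trivially h /\ forall a, commute (J h) a.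
Proof.
apply: (@subgroup_generated_sub _ _
  [set h | acts_trivially h /\ forall a, commute (J h) a]); last first.
  move=> _ [x _ <-] /=; have [_ _ xd tr] := degreeP x.
  by split=> // a; rewrite bpowE; apply: rgenX_central.
split=> [|g k [gX gC] [kX kC]|g [gX gC]] /=.
- split=> [|a]; first exact: acts_trivially1.
  by rewrite structure_cocycle1; apply/commute_sym/commute1.
- split=> [|a]; first exact: acts_triviallyM.
  rewrite structure_cocycle_trivial //.
  by apply/commute_sym/commuteM; apply/commute_sym; [exact: gC|exact: kC].
- split=> [|a]; first exact: acts_triviallyV.
  have -> : J g^-1 = (J g)^-1.
    apply: (mulIg (J g)).
    by rewrite -structure_cocycle_trivial // !mulVg structure_cocycle1.
  exact/commute_sym/commuteV/commute_sym/gC.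
Qed.

Lemma structure_cocycleMZ g h : Z h -> J (g * h) = J g * J h.
Proof.
by case/degree_subgroup_central=> hX _; exact: structure_cocycle_trivial.
Qed.

Lemma central_gen_ract x (g : G) : central_gen (ract x g) = central_gen x ^ g.
Proof.
have [_ _ xd tr] := degreeP x.
by rewrite /central_gen degree_ract; apply: bpow_ract.
Qed.

Lemma central_gen_rack x y : central_gen (rack y x) = central_gen y.
Proof.
by rewrite /central_gen degree_rack bpow_rack //; case: (degreeP y).
Qed.

Lemma degree_subgroup_normal : is_normal_subgroup Z.
Proof.
have [Z1 ZM ZV] := degree_subgroupP.
split=> // g; apply: (@subgroup_generated_sub _ _ [set h | Z (h ^ g)]).
  split=> [|h k hZ kZ|h hZ] /=; first by rewrite conj1g.
    by rewrite conjMg; apply: ZM.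
  by rewrite conjVg; apply: ZV.
move=> _ [x _ <-] /=; rewrite -/(central_gen x) -central_gen_ract.
exact: central_gen_mem.
Qed.

(** * Rack orbits and freeness *)

Local Notation orb := (orbit 'P <<rho @: [set: X]%SET>>).

Definition orbit_index (x : X) : 'I_(rack_orbits r) :=
  enum_rank_in (imset_f orb (finset.in_setT x)) (orb x).

Lemma enum_val_orbit_index x : enum_val (orbit_index x) = orb x.
Proof. by apply: enum_rankK_in; apply: imset_f. Qed.

Lemma orbit_index_rack x y : orbit_index (rack y x) = orbit_index y.
Proof.
apply: enum_val_inj; rewrite !enum_val_orbit_index -rhoE.
by apply: (orbit_act 'P); apply: mem_gen; apply: imset_f.
Qed.

Lemma orbit_index_surj i : exists x, orbit_index x = i.
Proof.
have /imsetP[x _ xi] := enum_valP i.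
by exists x; apply: enum_val_inj; rewrite enum_val_orbit_index xi.
Qed.

(** The permutations preserving a fibre of [f] form a group. *)
Lemma orbit_index_ind (T : eqType) (f : X -> T) :
    (forall x y, f (rack y x) = f y) ->
  forall x y, orbit_index x = orbit_index y -> f x = f y.
Proof.
move=> f_rack x y xy; have {xy} : orb x = orb y.
  by rewrite -!enum_val_orbit_index xy.
move/orbit_eqP/orbitP => [s s_rho <-].
pose S := [set z | f z == f y]%SET.
have sub : <<rho @: [set: X]%SET>> \subset 'N(S | 'P).
  rewrite gen_subG; apply/fintype.subsetP => _ /imsetP[z _ ->].
  by apply/astabsP => t; rewrite !inE /= apermE rhoE f_rack.
have /astabsP/(_ y) := fintype.subsetP sub s s_rho.
by rewrite !inE eqxx => /eqP.
Qed.

Definition orbit_rep i : X := sval (cid (orbit_index_surj i)).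

Lemma orbit_repK i : orbit_index (orbit_rep i) = i.
Proof. by rewrite /orbit_rep; case: (cid _). Qed.

(** Counts generators by orbit; this is well defined because the relations of
the rack group replace a letter by another one of the same orbit. *)
Definition rack_degree : G' -> 'rV[int]_(rack_orbits r) :=
  pres_degree (fun x => delta_mx 0%R (orbit_index x)).

Fact rack_degree_respects u v :
  rack_rel r u v ->
  word_degree
    (fun x => delta_mx 0%R (orbit_index x) : 'rV[int]_(rack_orbits r)) u
  = word_degree (fun x => delta_mx 0%R (orbit_index x)) v.
Proof.
move=> [x [y [-> ->]]]; rewrite /word_degree !big_cons !big_nil /=.
by rewrite orbit_index_rack !GRing.addr0 GRing.addrC.
Qed.

Lemma rack_degreeM (a b : G') :
  rack_degree (a * b) = (rack_degree a + rack_degree b)%R.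
Proof. exact: pres_degreeM rack_degree_respects a b. Qed.

Lemma rack_degree_gen x :
  rack_degree (rgen x) = delta_mx 0%R (orbit_index x).
Proof. exact: pres_degree_gen rack_degree_respects x. Qed.

Lemma rack_degreeX (a : G') k :
  rack_degree (a ^+ k) = (k%:Z *: rack_degree a)%R.
Proof.
elim: k => [|k IHk].
  by rewrite GRing.scale0r; exact: pres_degree1 rack_degree_respects.
rewrite expgSr rack_degreeM IHk.
by rewrite -(addn1 k) PoszD GRing.scalerDl GRing.scale1r.
Qed.

Definition central_basis i : G := central_gen (orbit_rep i).

Lemma degree_subgroup_basis : Z = subgroup_generated (range central_basis).
Proof.
rewrite /degree_subgroup; congr subgroup_generated; apply/seteqP; split.
  move=> _ [x _ <-]; exists (orbit_index x) => //.
  apply: orbit_index_ind (orbit_repK _) => {}x y; exact: central_gen_rack.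
by move=> _ [i _ <-]; exists (orbit_rep i).
Qed.

Lemma central_basisC i j : commute (central_basis i) (central_basis j).
Proof.
apply: structure_cocycle_inj.
rewrite !structure_cocycleMZ; try exact: central_gen_mem.
by have [_] := degree_subgroup_central (central_gen_mem (orbit_rep i)); apply.
Qed.

Lemma rack_degree_basis u i :
  (rack_degree (J (int_combination central_basis u)) 0 i
   = u 0 i * (degree r (orbit_rep i))%:Z)%R.
Proof.
apply: (@deg_int_combination _ _ central_basis (fun g => rack_degree (J g))
  (fun i => degree r (orbit_rep i))) => [g h|j].
  rewrite -degree_subgroup_basis => hZ.
  by rewrite structure_cocycleMZ // rack_degreeM.
by rewrite J_central_gen rack_degreeX rack_degree_gen orbit_repK.
Qed.

Lemma degree_subgroup_free : free_abelian_of_rank Z (rack_orbits r).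
Proof.
exists (int_combination central_basis); split.
- exact: int_combinationD central_basisC.
- move=> u v uv; apply/rowP => i.
  have := congr1 (fun g => rack_degree (J g) 0%R i) uv.
  rewrite !rack_degree_basis; apply: GRing.mulIf; rewrite eqz_nat.
  by rewrite -lt0n ltnW // degree_gt1.
- by rewrite (int_combination_range central_basisC) degree_subgroup_basis.
Qed.

(** * Finiteness of the index *)

Definition rack_word (s : seq X) : G' := \prod_(x <- s) rgen x.

(** A letter [x] moves to the left of a word through [y x = x y'] with
[rho_x y' = y]; this changes letters before the first [x] only, so no later
occurrence of [x] is lost. *)
Lemma rack_word_extract x k s : (k <= count_mem x s)%N ->
  exists2 s', size s = (k + size s')%N &
    rack_word s = rgen x ^+ k * rack_word s'.
Proof.
have extract1 t : (0 < count_mem x t)%N -> exists t',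
    [/\ size t = (size t').+1, (count_mem x t <= (count_mem x t').+1)%N &
      rack_word t = rgen x * rack_word t'].
  elim: t => //= y t IHt; case: eqVneq => [-> _|_ /IHt [t' [st ct Et]]].
    by exists t; rewrite add1n /rack_word big_cons.
  exists ((rho x)^-1 y :: t'); rewrite add0n /= st; split=> //.
    by apply: leq_trans ct _; rewrite ltnS leq_addl.
  rewrite /rack_word !big_cons -/(rack_word _) Et !mulgA [in RHS]rack_genC.
  by rewrite permKV.
elim: k s => [|k IHk] s ks; first by exists s; rewrite // mul1g.
have [s1 [s_size s_count ->]] := extract1 s (leq_trans (ltn0Sn k) ks).
have [s' s1_size ->] := IHk s1 (leq_trans ks s_count).
by exists s'; rewrite ?s_size ?s1_size // expgS mulgA.
Qed.

Lemma size_count_mem (s : seq X) : size s = (\sum_x count_mem x s)%N.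
Proof.
elim: s => [|y s IHs] /=; first by rewrite big1.
rewrite big_split /= -IHs (bigD1 y) //= eqxx big1 // => x /negPf.
by rewrite eq_sym => ->.
Qed.

Definition degree_sum := (\sum_x degree r x)%N.

(** By the pigeonhole principle, a word longer than the sum of the degrees has
some letter [x] at least [d_x] times, and [x^d_x] is in the image of [Z]. *)
Lemma rack_word_reduce s : exists2 s', (size s' <= degree_sum)%N &
  exists2 h, Z h & rack_word s = rack_word s' * J h.
Proof.
have [Z1 ZM ZV] := degree_subgroupP.
have [n] := ubnP (size s); elim: n s => // n IHn s; rewrite ltnS => s_size.
case: (leqP (size s) degree_sum) => [|s_long].
  by exists s => //; exists 1; rewrite // structure_cocycle1 mulg1.
have [x xs] : exists x, (degree r x <= count_mem x s)%N.
  apply/existsP; apply: contraLR s_long => /existsPn s_count.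
  rewrite -leqNgt size_count_mem; apply: leq_sum => x _.
  by apply: ltnW; rewrite ltnNge.
have [s1 size_s ->] := rack_word_extract xs.
have [|s' s'_size [h hZ ->]] := IHn s1.
  apply: leq_trans s_size; rewrite size_s -[ltnLHS]add0n ltn_add2r.
  exact: ltnW (degree_gt1 x).
exists s' => //; exists (h * central_gen x).
  by apply: ZM => //; apply: central_gen_mem.
rewrite structure_cocycleMZ ?[RHS]mulgA; last exact: central_gen_mem.
rewrite J_central_gen; have [_ _ xd _] := degreeP x.
exact: rgenX_central.
Qed.

(** Modulo the image of [Z], the inverse of [x] is [x^(d_x - 1)]. *)
Lemma rack_word_cover (a : G') :
  exists s, exists2 h, Z h & a = rack_word s * J h.
Proof.
have [Z1 ZM ZV] := degree_subgroupP.
move: a; apply: presented_ind => [|x a].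
  by exists [::], 1; rewrite // /rack_word big_nil structure_cocycle1 mulg1.
split=> [] [s [h hZ Ea]]; last first.
  by exists (x :: s), h; rewrite // Ea /rack_word big_cons mulgA.
exists (nseq (degree r x).-1 x ++ s), (h * (central_gen x)^-1).
  exact: ZM hZ (ZV _ (central_gen_mem x)).
have nseqE k : rack_word (nseq k x) = rgen x ^+ k.
  elim: k => [|k IHk]; rewrite /rack_word ?big_nil //.
  by rewrite big_cons -/(rack_word _) IHk expgS.
have [d_gt0 _ xd _] := degreeP x.
apply: (mulgI (rgen x)); rewrite Ea /rack_word big_cat /=.
rewrite -!/(rack_word _) nseqE !mulgA -expgS prednK //.
rewrite -{1}(mulgVK (central_gen x) h).
rewrite (structure_cocycleMZ _ (central_gen_mem x)).
rewrite J_central_gen mulgA -[RHS]mulgA; exact/commute_sym/rgenX_central.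
Qed.

Lemma left_coset_mulZ g h : Z h -> left_coset Z (g * h) = left_coset Z g.
Proof.
move=> hZ; have [Z1 ZM ZV] := degree_subgroupP.
apply/seteqP; split=> _ [k kZ <-].
  by exists (h * k); [exact: ZM|rewrite mulgA].
by exists (h^-1 * k); [apply: ZM => //; exact: ZV|rewrite mulgA mulgK].
Qed.

Lemma degree_subgroup_finite_index : finite_set (left_cosets Z).
Proof.
pose lift (a : G') : G := sval (cid (structure_cocycle_surj a)).
pose F (w : {k : 'I_degree_sum.+1 & k.-tuple X}) :=
  left_coset Z (lift (rack_word (tagged w))).
apply: (sub_finite_set (B := range F)); last exact/finite_image/finite_finset.
move=> _ [g _ <-]; have [s0 [h0 h0Z Eg]] := rack_word_cover (J g).
have [s s_size [h hZ Es]] := rack_word_reduce s0.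
pose k : 'I_degree_sum.+1 := Ordinal (s_size : (size s < degree_sum.+1)%N).
exists (Tagged (fun k : 'I_degree_sum.+1 => k.-tuple X)
               (in_tuple s : k.-tuple X)) => //.
rewrite /F /=; set g0 := lift _.
have Jg0 : J g0 = rack_word s by rewrite /g0 /lift; case: (cid _).
have [Z1 ZM ZV] := degree_subgroupP; have hh0 : Z (h * h0) by apply: ZM.
suff -> : g = g0 * (h * h0) by rewrite left_coset_mulZ.
apply: structure_cocycle_inj.
by rewrite structure_cocycleMZ // structure_cocycleMZ // Jg0 mulgA -Es.
Qed.

(** * Injectivity of the map from the set to the quotient *)

Lemma struct_gen_coset_inj :
  injective gen <-> injective (fun x => left_coset Z (gen x)).
Proof.
have [Z1 ZM ZV] := degree_subgroupP.
split=> [inj|inj] x y; last by move=> xy; apply: inj; rewrite xy.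
move=> xy; have : left_coset Z (gen y) (gen y) by exists 1; rewrite ?mulg1.
rewrite -xy => -[h hZ Eh]; apply: inj; rewrite -Eh.
move: hZ Eh; rewrite degree_subgroup_basis.
rewrite -(int_combination_range central_basisC).
case=> u _ <- {h}; set h := int_combination _ u => Eh.
suff u0 : u = 0%R by rewrite /h u0 int_combination0 mulg1.
apply/rowP => i; rewrite [RHS]mxE.
have hZ : Z h.
  rewrite degree_subgroup_basis -(int_combination_range central_basisC).
  by exists u.
have := congr1 (fun g => rack_degree (J g) 0%R i) Eh.
rewrite structure_cocycleMZ // rack_degreeM !structure_cocycle_gen mxE.
rewrite rack_degree_basis !rack_degree_gen !mxE eqxx /=.
have := degree_gt1 (orbit_rep i).
(* [k * d] is a difference of two Kronecker symbols, and [d > 1] *)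
move: (degree r _) (u 0%R i) => d k d_gt1.
case: (i == orbit_index x) => /=; case: (i == orbit_index y) => /=; nia.
Qed.
End StructureGroup.

Theorem theorem5p6 (X : finType) (r : solution X) :
  [/\ is_normal_subgroup (degree_subgroup r),
      free_abelian_of_rank (degree_subgroup r) (rack_orbits r),
      finite_set (left_cosets (degree_subgroup r))
    & injective (struct_gen r) <->
      injective (fun x => left_coset (degree_subgroup r) (struct_gen r x))].
Proof.
split; [exact: degree_subgroup_normal|exact: degree_subgroup_free| |].
  exact: degree_subgroup_finite_index.
exact: struct_gen_coset_inj.
Qed.
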